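(* Let $n$ be a positive integer (sufficiently large) and let $m$ be an integer with $m>n^{2.5}$ and $m\le n^{C}$ for a fixed constant $C$. Then $M_{\mathsf{SH}}(m,n)\le \widetilde{\mathcal{O}}(n^{1/3})$, i.e. $M_{\mathsf{SH}}(m,n)\le n^{1/3}\cdot(\log n)^{\mathcal{O}(1)}$.
   Context: $[N]=\{0,\dots,N-1\}$; for positive integer $N$ and real $x$, $\mathfrak{m}_N(x)$ is the unique element of $(x+N\mathbb{Z})\cap[0,N)$; $\mathbb{Z}_N^{\times}$ is the set of $k\in[N]$ coprime to $N$. Smart linear hashing $\mathsf{SH}_m$ into $n$ bins: choose $a$ uniformly from $\mathbb{Z}_m^{\times}$ and place $x\in[m]$ in bin $\lfloor \mathfrak{m}_m(ax)/(m/n)\rfloor\in[n]$. The maxload on a set $X$ is the number of elements of $X$ in the fullest bin. $M_{\mathsf{SH}}(m,n)$ is the maximum, over all $n$-element $X\subset[m]$, of the expected maxload of $\mathsf{SH}_m$ on $X$. *)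

(* Defs.v *)
From HB Require Import structures.
From mathcomp Require Import all_boot all_order all_algebra.

Set Implicit Arguments.
Unset Strict Implicit.
Unset Printing Implicit Defensive.

Import Order.TTheory GRing.Theory Num.Theory.

Local Open Scope ring_scope.

(* [m] is ['I_m]; [coprime 0 1] holds, so the units modulo 1 are {0}. *)
Definition unitsmod (m : nat) : {set 'I_m} := [set a : 'I_m | coprime a m].

(* floor (m_m(a x) / (m / n)), the quotients being exact rational ones. *)
Definition sh_bin (m n : nat) (a x : 'I_m) : int :=
  Num.floor (((a * x) %% m)%N%:R / (m%:R / n%:R) : rat).

Definition sh_maxload (m n : nat) (a : 'I_m) (X : {set 'I_m}) : nat :=
  \max_(b < n) #|[set x in X | sh_bin n a x == b%:Z]|.

Definition sh_expected_maxload (R : realFieldType) (m n : nat)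
    (X : {set 'I_m}) : R :=
  (\sum_(a in unitsmod m) (sh_maxload n a X)%:R) / #|unitsmod m|%:R.

(* The default value 0 only matters when n > m, since the expected maxloads are
   nonnegative and an n-element subset of [m] exists as soon as n <= m. *)
Definition M_SH (R : realFieldType) (m n : nat) : R :=
  \big[Num.max/0]_(X : {set 'I_m} | #|X| == n) sh_expected_maxload R n X.

(* Main.v *)
Require Import Defs.
From HB Require Import structures.
From mathcomp Require Import all_boot all_order all_algebra.
From mathcomp Require Import reals exp.
From mathcomp Require Import zify ring lra.

Set Implicit Arguments.
Unset Strict Implicit.
Unset Printing Implicit Defensive.

Import Order.TTheory GRing.Theory Num.Theory.

(* Call a unit a rich if some bin of the multiplier a holds at least k elements
   of X, and let J be the set of primes j <= k / 4 not dividing m, except the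
   smallest ones. If a = j b is rich, then in the b-picture the k elements of the
   full bin are spread over j intervals of length m / (n j), equally spaced at
   distance m / j. Hence b has many pairs of X at distance < m / (n j). Moreover,
   for two primes j <> j' the two systems of intervals meet in at most one
   interval, so a Cauchy-Schwarz argument over the primes j for which j b is rich
   gives a number of close pairs of at least (k / 2) #{j : j b rich}. Summed over
   all b, the number of close pairs is at most about n m / k up to logarithms;
   since |J| is about k, there are at most n m / k^3 rich multipliers, again up
   to logarithms, and summing over k > n^(1/3) bounds the expected maxload. *)

(** * Primes and totients *)

Lemma prod_primes_logn (n : nat) :
  0 < n -> n = \prod_(p <- primes n) p ^ logn p n.
Proof. by move=> /prod_prime_decomp {1}->; rewrite prime_decompE big_map. Qed.

Lemma expn_size (n : nat) (s : seq nat) : n ^ size s = \prod_(p <- s) n.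
Proof. by elim: s => [|p s IH]; rewrite ?big_nil // big_cons -IH -expnS. Qed.

Lemma exp2_le_central_bin (N : nat) : 2 ^ N <= 'C(2 * N, N).
Proof.
elim: N => // N IH; rewrite expnS.
(* By Pascal's rule and symmetry, the next central coefficient is twice ['C((2 * N).+1, N)], which
   is at least ['C(2 * N, N)]. *)
have -> : 2 * N.+1 = (2 * N).+2 by lia.
have := mul_bin_diag (2 * N).+1 N; have := mul_bin_diag (2 * N) N.
have := binS (2 * N).+1 N; have := binS (2 * N) N.
have -> : 'C((2 * N).+1, N) = 'C((2 * N).+1, N.+1).
  by rewrite -bin_sub; [congr 'C(_, _); lia | lia].
nia.
Qed.

(* Kummer: in Legendre's formula each power of [p] contributes at most 1, and
   none above [2 * N] contributes. *)
Lemma pfactor_central_bin (N p : nat) :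
  0 < N -> prime p -> p ^ logn p 'C(2 * N, N) <= 2 * N.
Proof.
move=> N0 pp; have p1 := prime_gt1 pp.
apply: leq_trans (_ : p ^ trunc_log p (2 * N) <= _); last first.
  by apply: trunc_logP => //; lia.
rewrite leq_exp2l //; set t := trunc_log _ _.
have bin0 : 0 < 'C(2 * N, N) by rewrite bin_gt0; lia.
have : logn p (2 * N)`! = logn p 'C(2 * N, N) + 2 * logn p N`!.
  have NN : N <= 2 * N by lia.
  rewrite -(bin_fact NN) (_ : 2 * N - N = N); last by lia.
  by rewrite !lognM ?muln_gt0 ?fact_gt0 //; lia.
rewrite !logn_fact //.
(* Both Legendre sums are brought to the range up to [2 * N]; the added terms vanish because
   [N < p ^ k]. *)
have -> : \sum_(1 <= k < N.+1) N %/ p ^ k = \sum_(1 <= k < (2 * N).+1) N %/ p ^ k.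
  rewrite [RHS](@big_cat_nat _ _ _ N.+1) //=; last by lia.
  rewrite [X in _ + X]big_nat_cond [X in _ + X]big1 ?addn0 // => k.
  rewrite andbT => /andP[kN _]; apply: divn_small.
  by apply: leq_trans kN _; apply: ltnW; apply: ltn_expl.
have tle : t <= 2 * N.
  have := ltn_expl t p1; have : p ^ t <= 2 * N by apply: trunc_logP => //; lia.
  lia.
suff : \sum_(1 <= k < (2 * N).+1) 2 * N %/ p ^ k <=
    t + 2 * \sum_(1 <= k < (2 * N).+1) N %/ p ^ k by lia.
(* As a sum of indicators, [t] allows a comparison term by term: the floor of 2x exceeds twice the
   floor of x by at most 1, and [2 * N %/ p ^ k] is 0 for [k > t]. *)
have -> : t = \sum_(1 <= k < (2 * N).+1) (k <= t : nat).
  rewrite (@big_cat_nat _ _ _ t.+1) //=.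
  rewrite [X in X + _](_ : _ = t).
    rewrite [X in _ + X]big_nat_cond [X in _ + X]big1 ?addn0 // => k.
    by rewrite andbT => /andP[kN _]; rewrite leqNgt kN.
  rewrite big_nat_cond (eq_bigr (fun=> 1)).
    by rewrite -big_nat_cond sum_nat_const_nat; lia.
  by move=> k; rewrite andbT ltnS => /andP[_ ->].
rewrite big_distrr -big_split /= ; apply: leq_sum => k _.
have pk0 : 0 < p ^ k by rewrite expn_gt0; lia.
case: (leqP k t) => [_|tk].
  rewrite -ltnS -(ltn_pmul2r pk0).
  apply: leq_ltn_trans (leq_trunc_div _ _) _; move: (ltn_ceil N pk0).
  move: (N %/ _) => q; nia.
rewrite divn_small //; apply: leq_trans (trunc_log_ltn _ p1) _.
by rewrite leq_exp2l.
Qed.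

Lemma prime_dvd_fact_leq (p n : nat) : prime p -> p %| n`! -> p <= n.
Proof.
move=> pp; elim: n => [|n IH]; first by rewrite fact0 Euclid_dvd1.
by rewrite factS Euclid_dvdM // => /orP[/dvdn_leq -> //|/IH /leqW].
Qed.

(** Every prime dividing ['C(2 * N, N)] is at most [2 * N] and contributes a prime power below
    [2 ^ l], while the coefficient itself is at least [2 ^ N]. *)
Lemma chebyshev_lower (N : nat) :
  N <= (trunc_log 2 (2 * N)).+1 * count prime (iota 0 (2 * N).+1).
Proof.
case: (posnP N) => [-> //|N0]; set l := (trunc_log _ _).+1.
have bin0 : 0 < 'C(2 * N, N) by rewrite bin_gt0; lia.
rewrite -(leq_exp2l (m := 2)) //; apply: leq_trans (exp2_le_central_bin N) _.
rewrite expnM [X in X <= _](prod_primes_logn bin0).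
apply: leq_trans (_ : (2 ^ l) ^ size (primes 'C(2 * N, N)) <= _).
  rewrite expn_size.
  rewrite !big_seq; apply: leq_prod => p.
  rewrite mem_primes => /and3P[pp _ _].
  apply: leq_trans (pfactor_central_bin N0 pp) _.
  by apply: ltnW; apply: trunc_log_ltn.
rewrite leq_exp2l; last by rewrite -[X in X < _](expn0 2) ltn_exp2l.
rewrite -size_filter; apply: uniq_leq_size => [|p]; first exact: primes_uniq.
rewrite mem_primes mem_filter mem_iota => /and3P[pp _ pb]; rewrite pp /= add0n ltnS.
have : p %| (2 * N)`!.
  apply: dvdn_trans pb _; rewrite -(@bin_fact (2 * N) N) ?dvdn_mulr //; lia.
exact: prime_dvd_fact_leq.
Qed.

(** The entry of rank i, counted from 1, is at least i + 1, so its quotient p / (p - 1) is at most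
    (i + 1) / i, and these bounds telescope. *)
Lemma prod_le_size_prod_pred (s : seq nat) :
  sorted ltn s -> all (leq 2) s ->
  \prod_(p <- s) p <= (size s).+1 * \prod_(p <- s) p.-1.
Proof.
elim/last_ind: s => [|s q IH]; first by rewrite !big_nil.
move=> sq aq; have [srt sall q2] : [/\ sorted ltn s, all (leq 2) s & (size s).+2 <= q].
  split.
  - exact: subseq_sorted ltn_trans _ _ (subseq_rcons _ _) sq.
  - by move: aq; rewrite all_rcons => /andP[].
  - have /(uniq_leq_size) : uniq (rcons s q).
      by apply: sorted_uniq sq => //; [exact: ltn_trans|exact: ltnn].
    move=> /(_ (iota 2 (q.-1))); rewrite size_iota size_rcons => H.
    have q2 : 2 <= q by move: aq; rewrite all_rcons => /andP[].
    suff : (size s).+1 <= q.-1 by lia.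
    apply: H => x xs; rewrite mem_iota.
    have x2 : 2 <= x by exact: (allP aq).
    suff : x <= q by lia.
    move: xs; rewrite mem_rcons inE => /orP[/eqP -> //|xs].
    move: sq; rewrite (sorted_pairwise ltn_trans) pairwise_rcons.
    move=> /andP[] /allP /(_ x xs).
    by move=> /= xq _; lia.
rewrite -!cats1 !big_cat /= !big_seq1 size_cat /= addn1.
have {}IH := IH srt sall; move: IH q2; move: (size s) (\prod_(p <- s) p) (\prod_(p <- s) p.-1) => c u v.
case: q {sq aq} => // q H1 H2 /=.
by nia.
Qed.

Lemma size_primes_le_trunc_log (m : nat) : 0 < m -> size (primes m) <= trunc_log 2 m.
Proof.
move=> m0; apply: trunc_log_max => //.
rewrite [X in _ <= X](prod_primes_logn m0) expn_size.
rewrite !big_seq; apply: leq_prod => p.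
move=> pm; have : 0 < logn p m by rewrite logn_gt0.
move: pm; rewrite mem_primes => /and3P[/prime_gt1 p1 _ _] l0.
by rewrite -[X in X < _](expn0 p) ltn_exp2l.
Qed.

(** The quotient of [m] by its totient is the product of p / (p - 1) over the distinct primes of
    [m], of which there are at most log2 m. *)
Lemma leq_totient_log (m : nat) : 0 < m -> m <= (trunc_log 2 m).+1 * totient m.
Proof.
move=> m0; rewrite totientE // big_split /=.
rewrite {1}(prod_primes_logn m0).
rewrite (_ : \prod_(p <- primes m) p ^ logn p m =
  (\prod_(p <- primes m) p) * \prod_(p <- primes m) p ^ (logn p m).-1); last first.
  rewrite -big_split !big_seq; apply: eq_bigr => p.
  by rewrite -logn_gt0 => l0 /=; rewrite -expnS prednK.
rewrite mulnA leq_mul2r; apply/orP; right.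
apply: leq_trans (_ : (size (primes m)).+1 * \prod_(p <- primes m) p.-1 <= _).
  apply: prod_le_size_prod_pred (sorted_primes m) _.
  by apply/allP => p; rewrite mem_primes => /and3P[/prime_gt1].
by rewrite leq_mul2r ltnS size_primes_le_trunc_log // orbT.
Qed.

Lemma card_unitsmod (m : nat) : #|unitsmod m| = totient m.
Proof.
rewrite totient_count_coprime big_mkord /unitsmod cardsE -sum1_card big_mkcond /=.
by apply: eq_bigr => i _; rewrite [coprime m i]coprime_sym.
Qed.

(** The cut-off [J0] lets a single distance, [m / (n * J0)], serve all the primes at once;
    coprimality to [m] makes multiplication by each of them permute the units. *)
Definition admissible_primes (J0 N m : nat) : seq nat :=
  [seq p <- iota 0 (2 * N).+1 | [&& prime p, J0 <= p & coprime p m]].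

Lemma size_admissible_primes (J0 N m : nat) : 0 < m ->
  count prime (iota 0 (2 * N).+1) <= size (admissible_primes J0 N m) + J0 + trunc_log 2 m.
Proof.
move=> m0; rewrite -size_filter.
apply: leq_trans (_ : size (admissible_primes J0 N m ++ iota 0 J0 ++ primes m) <= _); last first.
  by rewrite !size_cat size_iota addnA leq_add2l size_primes_le_trunc_log.
apply: uniq_leq_size; first by rewrite filter_uniq ?iota_uniq.
move=> p; rewrite mem_filter !mem_cat mem_filter mem_primes mem_iota => /andP[pp ->].
rewrite pp m0 mem_iota /= add0n prime_coprime //.
by case: (leqP J0 p); case: (p %| m).
Qed.

(** * Close residues *)

Lemma eqn_modMr_coprime (d m b c : nat) :
  coprime d m -> (b * d == c * d %[mod m]) = (b == c %[mod m]).
Proof.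
move=> cop; wlog bc : b c / c <= b.
  move=> H; case: (leqP c b) => [/H //|/ltnW /H e].
  by rewrite eq_sym e eq_sym.
by rewrite !eqn_mod_dvd ?leq_mul2r ?bc ?orbT // -mulnBl Gauss_dvdl // coprime_sym.
Qed.

(* With [g = gcdn d m] and [m = g * M], the residue [b * d %% m] is [g * s] for
   some [s] determined by [b %% M]; subtracting [b %/ M < g] from it makes the
   map injective with positive values. *)
Lemma card_small_residues (m q d : nat) : 0 < m -> 0 < q ->
  #|[set b : 'I_m | (0 < (b * d) %% m) && ((b * d) %% m * q < m)]| * q <= m.
Proof.
move=> m0 q0; set B := [set b | _].
pose g := gcdn d m; pose M := m %/ g; pose d' := d %/ g.
have g0 : 0 < g by rewrite gcdn_gt0 m0 orbT.
have mE : m = g * M by rewrite mulnC divnK ?dvdn_gcdr.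
have dE : d = g * d' by rewrite mulnC divnK ?dvdn_gcdl.
have M0 : 0 < M by move: m0; rewrite mE muln_gt0 => /andP[].
have cop : coprime d' M.
  rewrite /coprime -(eqn_pmul2l g0) muln_gcdr -dE -mE muln1; exact: eqxx.
pose f (b : 'I_m) := (b * d) %% m - b %/ M.
have resE b : (b * d) %% m = g * ((b * d') %% M).
  by rewrite muln_modr -mE dE mulnCA.
have quo_lt (b : 'I_m) : b %/ M < g by rewrite ltn_divLR // -mE.
apply: leq_trans (leq_trunc_div m q); rewrite leq_mul2r; apply/orP; right.
rewrite cardE -(size_map f) -(size_iota 1 (m %/ q)).
apply: uniq_leq_size => [|v].
  rewrite map_inj_in_uniq ?enum_uniq // => b c.
  rewrite !mem_enum !inE /f !resE => /andP[b0 _] /andP[c0 _] fE.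
  have := quo_lt b; have := quo_lt c.
  have s0 : 0 < (b * d') %% M by move: b0; rewrite muln_gt0 => /andP[].
  have s'0 : 0 < (c * d') %% M by move: c0; rewrite muln_gt0 => /andP[].
  move=> qc qb.
  have [sE tE] : (b * d') %% M = (c * d') %% M /\ b %/ M = c %/ M.
    move: fE s0 s'0 qc qb; move: (_ %% M) (_ %% M) (b %/ M) (c %/ M) => s s' t t'.
    move=> fE s0 s'0 tg tg'.
    have gs u v : u < v -> g * u + g <= g * v.
      by rewrite addnC -mulnS leq_mul2l => ->; rewrite orbT.
    have := gs 0 _ s0; have := gs 0 _ s'0.
    have [/gs|/gs|ss] := ltngtP s s'; [lia|lia|].
    by move: fE; rewrite ss; split => //; lia.
  apply: val_inj => /=; rewrite (divn_eq b M) (divn_eq c M) tE; congr (_ + _).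
  by apply/eqP; rewrite -(eqn_modMr_coprime _ _ cop); apply/eqP.
move=> /mapP[b]; rewrite mem_enum inE mem_iota /f => /andP[b0 bq] ->.
have := quo_lt b; have h : g <= (b * d) %% m.
  by rewrite resE leq_pmulr //; move: b0; rewrite resE muln_gt0 => /andP[].
have : (b * d) %% m <= m %/ q by rewrite leq_divRL // ltnW.
move: h; move: (_ %% m) (b %/ M) (m %/ q); clear; lia.
Qed.

(* [|u - v| < m / n], without subtraction or division. *)
Definition close (m n u v : nat) : bool := (u * n < v * n + m) && (v * n < u * n + m).

(* Two classes [t / j] and [t' / j'] modulo 1 can only meet near a common
   point because distinct values of [t / j - t' / j'] are [1 / (j * j')] apart. *)
Lemma close_quotients_eq (m n j j' y z : nat) :
  0 < m -> coprime j j' -> j + j' <= n -> y < m -> z < m ->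
  close m n ((j * y) %% m) ((j * z) %% m) ->
  close m n ((j' * y) %% m) ((j' * z) %% m) ->
  (j * y) %/ m = (j * z) %/ m.
Proof.
move=> m0 cop jn ym zm.
have [->|j0] := posnP j; first by rewrite !mul0n.
have := divn_eq (j * y) m; have := divn_eq (j * z) m.
have := divn_eq (j' * y) m; have := divn_eq (j' * z) m.
have : (j * y) %/ m < j by rewrite ltn_divLR // ltn_pmul2l.
have : (j * z) %/ m < j by rewrite ltn_divLR // ltn_pmul2l.
move: (_ %/ m) (_ %/ m) (_ %/ m) (_ %/ m) => s t s' t'.
move: ((j * y) %% m) ((j * z) %% m) ((j' * y) %% m) ((j' * z) %% m) => u v u' v'.
move=> sj tj e4 e3 e2 e1 /andP[c1 c2] /andP[c3 c4].
(* Here [s'], [t'] are the quotients of [j * y], [j * z], and [s], [t] those of [j' * y], [j' * z].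
   Computing [j * j' * y] in two ways eliminates [y]; likewise for [z]. *)
have f1 : j' * s' * m + j' * u = j * s * m + j * u'.
  by move: (congr1 (muln j') e1) (congr1 (muln j) e3); clear; nia.
have f2 : j' * t' * m + j' * v = j * t * m + j * v'.
  by move: (congr1 (muln j') e2) (congr1 (muln j) e4); clear; nia.
(* The two closeness bounds, weighted by [j] and [j'], add up to [(j + j') * m / n <= m]. *)
have b1 : (j * u' + j' * v) * n < (j * v' + j' * u) * n + n * m.
  have : j * (u' * n) < j * (v' * n + m) by rewrite ltn_pmul2l.
  have : j' * (v * n) <= j' * (u * n + m) by rewrite leq_mul2l ltnW ?orbT.
  have : (j + j') * m <= n * m by rewrite leq_mul2r jn orbT.
  by clear; nia.
have b2 : (j * v' + j' * u) * n < (j * u' + j' * v) * n + n * m.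
  have : j * (v' * n) < j * (u' * n + m) by rewrite ltn_pmul2l.
  have : j' * (u * n) <= j' * (v * n + m) by rewrite leq_mul2l ltnW ?orbT.
  have : (j + j') * m <= n * m by rewrite leq_mul2r jn orbT.
  by clear; nia.
(* The integers [j' * s' - j * s] and [j' * t' - j * t] differ by less than 1 in absolute value,
   hence are equal. *)
have key : j' * s' + j * t = j' * t' + j * s.
  have H a b p q : a * m + p = b * m + q -> p * n < q * n + n * m -> b <= a.
    move=> e lt; rewrite leqNgt; apply/negP => ab.
    have : a.+1 * m <= b * m by rewrite leq_mul2r ab orbT.
    move: (congr1 (muln n) e) => e'.
    by move=> /(leq_mul (leqnn n)); move: lt e'; clear; nia.
  apply/eqP; rewrite eqn_leq; apply/andP; split.
    by apply: (H _ _ (j * u' + j' * v) (j * v' + j' * u)) => //; move: f1 f2; clear; nia.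
  by apply: (H _ _ (j * v' + j' * u) (j * u' + j' * v)) => //; move: f1 f2; clear; nia.
(* By coprimality [j] divides the difference of [s'] and [t'], both of which are below [j]. *)
have aux a b c d : a < j -> j' * a + j * d = j' * b + j * c -> a <= b.
  move=> aj e; rewrite leqNgt; apply/negP => ba.
  have : j %| a - b.
    rewrite -(Gauss_dvdr _ cop) mulnBr; apply/dvdnP; exists (c - d).
    rewrite mulnBl; move: e; clear; nia.
  by move/dvdn_leq; rewrite subn_gt0 => /(_ ba); move: aj; clear; lia.
by apply/eqP; rewrite eqn_leq (aux _ _ _ _ tj key) (aux _ _ _ _ sj (esym key)).
Qed.

(** * Families of rich sets with small intersections *)

Local Open Scope ring_scope.

(** In a clique every degree is at least [#|A| - 1]; being also positive, it is at least [#|A| / 2],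
    so each term is at most [2 / #|A|]. *)
Lemma sum_inv_clique (T : finType) (d : T -> nat) (A : {set T}) :
  {in A, forall x, (0 < d x)%N} -> {in A, forall x, (#|A| <= (d x).+1)%N} ->
  \sum_(x in A) (d x)%:R^-1 <= 2%:R :> rat.
Proof.
move=> d0 dA; have [->|An0] := eqVneq A set0; first by rewrite big_set0.
have c0 : 0 < #|A|%:R :> rat by rewrite ltr0n card_gt0.
apply: le_trans (_ : \sum_(x in A) 2%:R / #|A|%:R <= _).
  apply: ler_sum => x xA; have dx := d0 x xA.
  rewrite ler_pdivlMr // ler_pdivrMl ?ltr0n // -natrM ler_nat.
  by have := dA x xA; lia.
by rewrite sumr_const -[leLHS]mulr_natr mulfVK ?lt0r_neq0.
Qed.

Section RichSets.

(** In the application [B j] is a full bin of the multiplier [j * b], [cls j x] is the index of the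
    interval containing [x] in the b-picture, and [E] is closeness there. *)
Variables (T : finType) (X : {set T}) (E : rel T) (S : seq nat) (k : nat).
Variables (B : nat -> {set T}) (cls : nat -> T -> nat).

Hypothesis S_uniq : uniq S.
Hypothesis S_size : (4 * size S <= k)%N.
Hypothesis S_small : {in S, forall j, (4 * j <= k)%N}.
Hypothesis B_sub : {in S, forall j, B j \subset X}.
Hypothesis B_rich : {in S, forall j, (k <= #|B j|)%N}.
Hypothesis cls_lt : {in S, forall j, {in B j, forall x, (cls j x < j)%N}}.
Hypothesis cls_close : {in S, forall j, {in B j &, forall x z,
  x != z -> cls j x = cls j z -> E x z}}.
Hypothesis cls_meet : {in S &, forall i j, i != j ->
  {in B i :&: B j &, forall x z, cls i x = cls i z}}.

Let nbrs x := [set z in X | (z != x) && E x z].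
Let d x := #|nbrs x|.
(** Elements alone in their class are dropped, so that the weights [1 / d x] are only used at
    positive degrees. *)
Let B' j := [set x in B j | [exists z in B j, (z != x) && (cls j z == cls j x)]].
Let f x : rat := \sum_(j <- S) (x \in B' j)%:R.

Let deg_gt0 j x : j \in S -> x \in B' j -> (0 < d x)%N.
Proof.
move=> jS; rewrite inE => /andP[xB /existsP[z /and3P[zB zx /eqP e]]].
rewrite card_gt0; apply/set0Pn; exists z.
by rewrite !inE zx (subsetP (B_sub jS)) //=; apply: cls_close (esym e); rewrite // eq_sym.
Qed.

Let clique_deg j (A : {set T}) : j \in S -> A \subset B' j ->
  {in A &, forall x z, cls j x = cls j z} -> \sum_(x in A) (d x)%:R^-1 <= 2%:R :> rat.
Proof.
move=> jS AB eqA; have BA x : x \in A -> x \in B j.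
  by move/(subsetP AB); rewrite inE => /andP[].
apply: sum_inv_clique => x xA; first by apply: deg_gt0 jS _; apply: (subsetP AB).
rewrite (cardsD1 x A) xA add1n ltnS; apply: subset_leq_card.
apply/subsetP => z; rewrite !inE => /andP[zx zA].
rewrite zx (subsetP (B_sub jS)) ?BA //=.
by apply: cls_close (eqA _ _ xA zA) => //; rewrite ?BA // eq_sym.
Qed.

(** On the dropped elements [cls j] is injective, so at most [j <= k / 4] of them are lost. *)
Let card_B' j : j \in S -> (3 * k <= 4 * #|B' j|)%N.
Proof.
move=> jS; suff : (#|B j :\: B' j| <= j)%N.
  have sub : B' j \subset B j by apply/subsetP => x; rewrite inE => /andP[].
  have := cardsID (B' j) (B j); rewrite (setIidPr sub).
  by have := B_rich jS; have := S_small jS; lia.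
rewrite cardE -(size_map (cls j)) -[leqRHS](size_iota 0).
apply: uniq_leq_size => [|v].
  rewrite map_inj_in_uniq ?enum_uniq // => x z.
  rewrite !mem_enum !inE => /andP[nx xB] /andP[_ zB] e.
  apply/eqP; apply: contraNT nx => xz; rewrite xB; apply/existsP; exists z.
  by rewrite zB eq_sym xz e /=.
move=> /mapP[x]; rewrite mem_enum inE => /andP[_ xB] ->.
by rewrite mem_iota add0n (cls_lt jS).
Qed.

(** The classes split [B' j] into [j] cliques, each of weight at most 2. *)
Let sum_inv_B' j : j \in S -> \sum_(x in B' j) (d x)%:R^-1 <= (2 * j)%:R :> rat.
Proof.
move=> jS; have cl x : x \in B' j -> (cls j x < j)%N.
  by rewrite inE => /andP[xB _]; apply: cls_lt.
case: j jS cl => [|j] jS cl.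
  rewrite big1 // => x /cl; by [].
rewrite (partition_big (fun x => inord (cls j.+1 x) : 'I_j.+1) xpredT) //=.
apply: le_trans (_ : \sum_(t : 'I_j.+1) 2%:R <= _); last first.
  by rewrite sumr_const card_ord natrM -[leLHS]mulr_natr.
apply: ler_sum => t _.
rewrite (eq_bigl (mem [set x in B' j.+1 | inord (cls j.+1 x) == t])); last first.
  by move=> x; rewrite !inE.
apply: clique_deg jS _ _.
  by apply/subsetP => x; rewrite inE => /andP[].
move=> x z; rewrite !inE => /andP[xB /eqP xt] /andP[zB /eqP zt].
have xl : (cls j.+1 x < j.+1)%N by apply: cl; rewrite inE.
have zl : (cls j.+1 z < j.+1)%N by apply: cl; rewrite inE.
by rewrite -(inordK xl) -(inordK zl) xt zt.
Qed.

(** By [cls_meet] the intersection lies in one class of [i], so it is a single clique. *)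
Let sum_inv_pair i j : i \in S -> j \in S -> i != j ->
  \sum_(x in B' i :&: B' j) (d x)%:R^-1 <= 2%:R :> rat.
Proof.
move=> iS jS ij; apply: (clique_deg iS); first exact: subsetIl.
have sub x : x \in B' i :&: B' j -> x \in B i :&: B j.
  by rewrite !inE => /andP[/andP[-> _] /andP[-> _]].
by move=> x z /sub xB /sub zB; exact: (cls_meet iS jS ij xB zB).
Qed.

Let sum_f : 3%:R * k%:R * (size S)%:R <= 4%:R * \sum_(x in X) f x.
Proof.
rewrite exchange_big /= mulr_sumr.
apply: le_trans (_ : \sum_(j <- S) 3%:R * k%:R <= _).
  by rewrite big_const_seq count_predT iter_addr addr0 mulr_natr.
rewrite !big_seq; apply: ler_sum => j jS.
suff -> : \sum_(x in X) (x \in B' j)%:R = #|B' j|%:R :> rat.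
  by rewrite -!natrM ler_nat card_B'.
rewrite -sum1_card natr_sum big_mkcond [RHS]big_mkcond /=; apply: eq_bigr => x _.
case: (boolP (x \in B' j)) => [|_]; last by case: ifP.
by rewrite inE => /andP[xB _]; rewrite (subsetP (B_sub jS)).
Qed.

(** Expanding the square gives a sum over pairs of indices. For fixed [i], the diagonal term is at
    most [2 * i <= k / 2] and the others together at most [2 * size S <= k / 2]. *)
Let sum_f2 : \sum_(x in X) f x ^+ 2 / (d x)%:R <= k%:R * (size S)%:R.
Proof.
have -> : \sum_(x in X) f x ^+ 2 / (d x)%:R =
    \sum_(i <- S) \sum_(j <- S) \sum_(x in B' i :&: B' j) (d x)%:R^-1.
  rewrite (eq_bigr (fun x => \sum_(i <- S) \sum_(j <- S)
      if x \in B' i :&: B' j then (d x)%:R^-1 else 0)); last first.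
    move=> x _; rewrite expr2 /f !mulr_suml; apply: eq_bigr => i _.
    rewrite mulr_sumr mulr_suml; apply: eq_bigr => j _; rewrite in_setI.
    by case: (x \in B' i); case: (x \in B' j); rewrite /= ?mulr1 ?mul1r ?mul0r ?mulr0.
  rewrite exchange_big /= [LHS]big_seq [RHS]big_seq; apply: eq_bigr => i iS.
  rewrite exchange_big; apply: eq_bigr => j _.
  rewrite big_mkcond [RHS]big_mkcond /=; apply: eq_bigr => x _.
  case: (boolP (x \in B' i :&: B' j)) => [|_]; last by case: ifP.
  by rewrite !inE => /andP[/andP[xB _] _]; rewrite (subsetP (B_sub iS)).
apply: le_trans (_ : \sum_(i <- S) k%:R <= _); last first.
  by rewrite big_const_seq count_predT iter_addr addr0 mulr_natr.
rewrite !big_seq; apply: ler_sum => i iS.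
rewrite (big_rem i) //= setIid.
apply: le_trans (_ : (2 * i)%:R + \sum_(j <- rem i S) 2%:R <= _).
  apply: lerD; first exact: sum_inv_B'.
  rewrite !big_seq; apply: ler_sum => j; rewrite mem_rem_uniq // !inE => /andP[ji jS].
  by apply: sum_inv_pair; rewrite // eq_sym.
rewrite big_const_seq count_predT iter_addr addr0 -mulrnA -natrD ler_nat.
rewrite size_rem //; move: (S_small iS) S_size; move: (size S) => s; clear; lia.
Qed.

(** Summing the inequality 2 f <= d + f^2 / d, the left side is at least 3/2 of [size S * k] and the
    last term at most [size S * k], which leaves half of it for the degrees. *)
Lemma rich_close_pairs : (size S * k <= 2 * \sum_(x in X) #|[set z in X | (z != x) && E x z]|)%N.
Proof.
have amgm x : 2%:R * f x <= (d x)%:R + f x ^+ 2 / (d x)%:R.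
  (* In degree 0 the quotient is 0 by convention, and [f x = 0] because elements of any [B' j] have
     a neighbour. *)
  have [d0|dn0] := posnP (d x).
    suff -> : f x = 0 by rewrite d0 mulr0 expr0n /= mul0r addr0.
    rewrite /f big_seq big1 // => j jS.
    by case: (boolP (x \in B' j)) => // /(deg_gt0 jS); rewrite d0.
  have d0 : 0 < (d x)%:R :> rat by rewrite ltr0n.
  have : f x ^+ 2 / (d x)%:R * (d x)%:R = f x ^+ 2 by rewrite mulfVK ?lt0r_neq0.
  move: (f x ^+ 2 / _) => q qd; rewrite -(ler_pM2r d0).
  by have := sqr_ge0 ((d x)%:R - f x); nra.
have : 2%:R * \sum_(x in X) f x <= \sum_(x in X) ((d x)%:R + f x ^+ 2 / (d x)%:R).
  by rewrite mulr_sumr; apply: ler_sum => x _; apply: amgm.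
rewrite big_split /= -natr_sum => H.
rewrite -(ler_nat rat) !natrM mulrC; move: sum_f sum_f2 H; lra.
Qed.

End RichSets.

Local Close Scope ring_scope.

(** * Rich multipliers *)

Lemma sh_bin_close (m n : nat) (a x z : 'I_m) (c : int) :
  0 < m -> 0 < n -> sh_bin n a x == c -> sh_bin n a z == c ->
  close m n ((a * x) %% m) ((a * z) %% m).
Proof.
move=> m0 n0; rewrite /sh_bin; move: ((a * x) %% m) ((a * z) %% m) => u v.
have H (w w' : nat) : Num.floor (w%:R / (m%:R / n%:R) : rat) == c ->
    Num.floor (w'%:R / (m%:R / n%:R) : rat) == c -> w * n < w' * n + m.
  rewrite !floor_eq invf_div !mulrA => /andP[_ h1] /andP[h2 _].
  have m0' : (0 < m%:R :> rat)%R by rewrite ltr0n.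
  move: h1 h2; rewrite ltr_pdivrMr // ler_pdivlMr // rmorphD /= => h1 h2.
  rewrite -(ltr_nat rat) natrD !natrM; move: h1 h2; clear; nra.
by move=> hu hv; apply/andP; split; apply: H.
Qed.

Definition scale_ord (m : nat) (m0 : 0 < m) (j : nat) (b : 'I_m) : 'I_m :=
  Ordinal (ltn_pmod (j * b) m0).

Lemma scale_ord_inj (m : nat) (m0 : 0 < m) (j : nat) :
  coprime j m -> injective (scale_ord m0 j).
Proof.
move=> cop b c /(congr1 val) /= /eqP; rewrite ![j * _]mulnC eqn_modMr_coprime //.
by rewrite !modn_small // => /eqP e; apply: val_inj.
Qed.

(** With equal quotients, the distance of [y] and [z] is exactly 1/j times that of the residues. *)
Lemma close_of_scaled (m n j J0 y z : nat) :
  0 < m -> J0 <= j -> (j * y) %/ m = (j * z) %/ m ->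
  close m n ((j * y) %% m) ((j * z) %% m) -> close m (n * J0) y z.
Proof.
move=> m0 Jj e.
have H u v : (j * u) %/ m = (j * v) %/ m ->
    (j * u) %% m * n < (j * v) %% m * n + m -> u * (n * J0) < v * (n * J0) + m.
  move=> q; have := divn_eq (j * u) m; have := divn_eq (j * v) m; rewrite q.
  move: (_ %/ m) (_ %% m) (_ %% m) => t r s e1 e2 lt.
  have [uv|vu] := leqP u v.
    by rewrite -addn1 leq_add ?leq_mul2r ?uv ?orbT.
  have lt' : j * u * n < j * v * n + m by rewrite e1 e2 !mulnDl; move: lt; clear; lia.
  have : (u - v) * n * J0 <= (u - v) * n * j by rewrite leq_mul2l Jj orbT.
  move: lt'; rewrite -(subnK (ltnW vu)); move: (u - v) => w; rewrite addnK.
  by clear; nia.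
by case/andP=> h1 h2; apply/andP; split; apply: H.
Qed.

(** For a unit [b] the two residues differ, so one of b(x - z), b(z - x) has residue strictly
    between 0 and [m / q]; [card_small_residues] bounds both cases. In [D], subtraction modulo [m]
    is adding [m - z] or [m - x]. *)
Lemma card_close_units (m q : nat) (x z : 'I_m) : 0 < m -> 0 < q -> z != x ->
  #|[set b in unitsmod m | close m q ((b * x) %% m) ((b * z) %% m)]| * q <= 2 * m.
Proof.
move=> m0 q0 zx.
pose D (d : nat) := [set b : 'I_m | (0 < (b * d) %% m) && ((b * d) %% m * q < m)].
have sub : [set b in unitsmod m | close m q ((b * x) %% m) ((b * z) %% m)] \subset
    D (x + (m - z)) :|: D (z + (m - x)).
  apply/subsetP => b; rewrite !inE => /andP[cop].
  have res_diff (u v : 'I_m) : (b * v) %% m <= (b * u) %% m ->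
      (b * (u + (m - v))) %% m = (b * u) %% m - (b * v) %% m.
    move=> le; rewrite -[RHS](@modn_small _ m); last first.
      by apply: leq_ltn_trans (leq_subr _ _) _; rewrite ltn_pmod.
    apply/eqP; rewrite -(eqn_modDr ((b * v) %% m)) subnK // modn_mod modnDmr.
    rewrite -mulnDr -addnA subnK; last by apply/ltnW.
    by rewrite mulnDr addnC modnMDl.
  have neq : (b * x) %% m != (b * z) %% m.
    apply: contraNneq zx => /eqP; rewrite ![b * _]mulnC eqn_modMr_coprime //.
    by rewrite !modn_small // eq_sym.
  have sub_lt (u v : nat) : u < v + m -> u - v < m by move: m0; clear; lia.
  case/andP=> h1 h2; move: neq; rewrite neq_ltn => /orP[lt|lt]; apply/orP; [right|left].
    rewrite res_diff ?(ltnW lt) // subn_gt0 lt /= mulnBl.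
    exact: sub_lt.
  rewrite res_diff ?(ltnW lt) // subn_gt0 lt /= mulnBl.
  exact: sub_lt.
have := subset_leq_card sub; have := leq_card_setU (D (x + (m - z))) (D (z + (m - x))).
have := card_small_residues (x + (m - z)) m0 q0; have := card_small_residues (z + (m - x)) m0 q0.
rewrite -/(D _) -/(D _) => c1 c2 cU cS.
rewrite mul2n -addnn; apply: leq_trans (leq_add c2 c1).
by rewrite -mulnDl leq_mul2r (leq_trans cS cU) orbT.
Qed.

Section CountRich.

Variables (m n k J0 : nat) (X : {set 'I_m}) (J : seq nat).
Hypothesis m0 : 0 < m.
Hypothesis n0 : 0 < n.
Hypothesis J00 : 0 < J0.
Hypothesis Xn : #|X| = n.
Hypothesis kn : k <= n.
Hypothesis J_uniq : uniq J.
Hypothesis J_size : 4 * size J <= k.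
Hypothesis J_prime : {in J, forall j, [/\ prime j, coprime j m, J0 <= j & 4 * j <= k]}.

Let A := [set a in unitsmod m | k <= sh_maxload n a X].
Let bin a (c : 'I_n) := [set x in X | sh_bin n a x == Posz c].
(** Any bin with at least [k] elements serves; the empty default makes [fullest_close] hold for
    every [a]. *)
Let fullest a := if [pick c : 'I_n | k <= #|bin a c|] is Some c then bin a c else set0.

Let fullest_sub a : fullest a \subset X.
Proof.
rewrite /fullest; case: pickP => [c _|_]; last exact: sub0set.
by apply/subsetP => x; rewrite inE => /andP[].
Qed.

Let fullest_rich a : a \in A -> k <= #|fullest a|.
Proof.
rewrite inE => /andP[_ ka]; rewrite /fullest; case: pickP => // none.
move: ka; rewrite leqNgt; have [->//|k0] := posnP k.
suff -> : sh_maxload n a X < k by [].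
rewrite /sh_maxload; case: k k0 none => // k' _ none; rewrite ltnS.
by apply/bigmax_leqP => c _; have /negbT := none c; rewrite -ltnNge ltnS.
Qed.

Let fullest_close a : {in fullest a &, forall x z : 'I_m, close m n ((a * x) %% m) ((a * z) %% m)}.
Proof.
rewrite /fullest; case: pickP => [c _|_] x z; last by rewrite inE.
by rewrite !inE => /andP[_ xc] /andP[_ zc]; apply: sh_bin_close xc zc.
Qed.

Let mu b := size [seq j <- J | scale_ord m0 j b \in A].
Let nclose (b : 'I_m) := \sum_(x in X) #|[set z in X | (z != x) &&
  close m (n * J0) ((b * x) %% m) ((b * z) %% m)]|.

Let mu_le (b : 'I_m) : mu b * k <= 2 * nclose b.
Proof.
pose y (x : 'I_m) := (b * x) %% m.
(* The bins of the multiplier [j * b] are read off from the b-picture [y], whose points fall into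
   classes by the quotient of [j * y x] by [m]. *)
have res_scale j (x : 'I_m) : (scale_ord m0 j b * x) %% m = (j * y x) %% m.
  by rewrite /= modnMml modnMmr mulnA.
have inJ j : j \in [seq j <- J | scale_ord m0 j b \in A] -> j \in J /\ scale_ord m0 j b \in A.
  by rewrite mem_filter => /andP[].
have y_lt x : y x < m by rewrite ltn_pmod.
apply: (@rich_close_pairs _ X (fun x z => close m (n * J0) (y x) (y z)) _ k
  (fun j => fullest (scale_ord m0 j b)) (fun j x => (j * y x) %/ m)).
- by rewrite filter_uniq.
- apply: leq_trans J_size; rewrite leq_mul2l /= size_filter; exact: count_size.
- by move=> j /inJ[/J_prime[]].
- by move=> j _; apply: fullest_sub.
- by move=> j /inJ[_ /fullest_rich].
- move=> j /inJ[/J_prime[/prime_gt0 j0 _ _ _] _] x _.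
  by rewrite ltn_divLR // ltn_pmul2l.
- move=> j /inJ[/J_prime[_ _ Jj _] _] x z xB zB _ e.
  by apply: close_of_scaled Jj e _ => //; rewrite -!res_scale; apply: fullest_close xB zB.
- move=> i j /inJ[/J_prime[pi _ _ ik] _] /inJ[/J_prime[pj _ _ jk] _] ij x z.
  rewrite !inE => /andP[xi xj] /andP[zi zj].
  apply: (@close_quotients_eq m n i j) => //.
  + by rewrite prime_coprime // dvdn_prime2.
  + by move: ik jk kn; clear; lia.
  + by rewrite -!res_scale; apply: fullest_close xi zi.
  + by rewrite -!res_scale; apply: fullest_close xj zj.
Qed.

(** For each [j] in [J], multiplication by [j] permutes the units, so every rich multiplier is hit
    exactly once. *)
Let sum_mu : \sum_(b in unitsmod m) mu b = size J * #|A|.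
Proof.
rewrite (eq_bigr (fun b => \sum_(j <- J) (scale_ord m0 j b \in A))); last first.
  by move=> b _; rewrite /mu size_filter -sum1_count big_mkcond; apply: eq_bigr => j _; case: ifP.
rewrite exchange_big /= (eq_big_seq (fun=> #|A|)).
  by rewrite big_const_seq count_predT iter_addn_0 mulnC.
move=> j /J_prime[_ cop _ _].
rewrite -(card_preimset A (@scale_ord_inj m m0 j cop)) -sum1_card big_mkcond [RHS]big_mkcond.
apply: eq_bigr => b _; rewrite [b \in _ @^-1: _]inE.
case: ifP => // bU; case: ifP => // /[!inE] /andP[+ _].
by rewrite /= coprime_modl coprimeMl cop /= => cb; move: bU; rewrite inE cb.
Qed.

(** Counted by pairs instead: each of at most [n ^ 2] pairs of distinct elements is close for at
    most [2 * m / (n * J0)] units. *)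
Let sum_nclose : (\sum_(b in unitsmod m) nclose b) * J0 <= 2 * n * m.
Proof.
have -> : \sum_(b in unitsmod m) nclose b = \sum_(x in X) \sum_(z in X | z != x)
    #|[set b in unitsmod m | close m (n * J0) ((b * x) %% m) ((b * z) %% m)]|.
  rewrite /nclose exchange_big; apply: eq_bigr => x _ /=.
  under eq_bigr => b _ do rewrite -sum1_card.
  under [RHS]eq_bigr => z _ do rewrite -sum1_card.
  rewrite (exchange_big_dep (fun z => (z \in X) && (z != x))) /=; last first.
    by move=> b z _; rewrite !inE => /and3P[-> -> _].
  apply: eq_bigr => z /andP[zX zx]; apply: eq_bigl => b.
  by rewrite !inE zX zx.
rewrite -(leq_pmul2r n0) -mulnA [J0 * n]mulnC big_distrl /=.
apply: leq_trans (_ : \sum_(x in X) (n * (2 * m)) <= _); last first.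
  by rewrite sum_nat_const Xn; clear; nia.
apply: leq_sum => x _; rewrite big_distrl /=.
apply: leq_trans (_ : \sum_(z in X | z != x) 2 * m <= _).
  by apply: leq_sum => z /andP[_ zx]; rewrite card_close_units // muln_gt0 n0.
rewrite sum_nat_cond_const -Xn leq_mul2r subset_leq_card ?orbT //.
by apply/subsetP => z; rewrite inE => /andP[].
Qed.

Lemma card_rich_mul_le : size J * #|A| * k * J0 <= 4 * n * m.
Proof.
rewrite -sum_mu.
have : (\sum_(b in unitsmod m) mu b) * k <= 2 * \sum_(b in unitsmod m) nclose b.
  by rewrite big_distrl big_distrr /=; apply: leq_sum => b _; apply: mu_le.
rewrite -(leq_pmul2r J00) => /leq_trans; apply.
by have := sum_nclose; clear; nia.
Qed.

End CountRich.

Lemma card_rich_multipliers (m n k : nat) (X : {set 'I_m}) :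
  let l := (trunc_log 2 n).+1 in let w := (trunc_log 2 m).+1 in
  0 < m -> #|X| = n -> k <= n -> 64 * l * w <= k ->
  #|[set a in unitsmod m | k <= sh_maxload n a X]| * k ^ 3 <=
    (128 * l) ^ 2 * w * n * totient m.
Proof.
move=> l w m0 Xn kn lw; have l0 : 0 < l by []. have w0 : 0 < w by [].
have l64 : 64 * l <= k by apply: leq_trans lw; rewrite leq_pmulr.
(* Primes up to [2 * N] satisfy [4 * j <= k]. With this [J0], the numbers below [J0] and the prime
   divisors of [m] each cost at most [k / 64] in Chebyshev's bound, which is about [k / 8]. *)
pose N := k %/ 8; pose J0 := k %/ (64 * l); pose J := admissible_primes J0 N m.
have J00 : 0 < J0 by rewrite divn_gt0 // muln_gt0.
have kN : 8 * N <= k by rewrite mulnC leq_trunc_div.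
have kN' : k < 8 * N + 8 by have := ltn_ceil k (isT : 0 < 8); rewrite -/N mulSn mulnC addnC.
have kJ : 64 * l * J0 <= k by rewrite mulnC leq_trunc_div.
have kJ' : k <= 128 * l * J0.
  have := @ltn_ceil k (64 * l); rewrite muln_gt0 /= l0 -/J0 => /(_ isT).
  by move: J00; clear; nia.
have kl : 64 <= k by apply: leq_trans l64; rewrite -[X in X <= _]muln1 leq_mul2l.
have JP : {in J, forall j, [/\ prime j, coprime j m, J0 <= j & 4 * j <= k]}.
  move=> j; rewrite mem_filter mem_iota add0n ltnS => /andP[/and3P[-> -> ->] jN].
  by split=> //; move: jN kN; clear; lia.
have Ju : uniq J by rewrite filter_uniq ?iota_uniq.
have Js : 4 * size J <= k.
  suff : size J <= 2 * N by move: kN; clear; lia.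
  rewrite -[leqRHS](size_iota 1); apply: uniq_leq_size => // j jJ.
  have [/prime_gt0 j0 _ _ _] := JP j jJ.
  by move: jJ; rewrite mem_filter !mem_iota => /andP[_] /=; move: j0; clear; lia.
have N2n : 2 * N <= n by move: kN kn; clear; lia.
have : N <= l * (size J + J0 + w.-1).
  apply: leq_trans (chebyshev_lower N) _; apply: leq_mul.
    by rewrite ltnS leq_trunc_log.
  exact: size_admissible_primes.
have {}lw : 64 * (l * w.-1) <= k.
  by apply: leq_trans lw; rewrite -mulnA !leq_mul2l leq_pred orbT.
move=> cheb; have kJs : k <= 32 * l * size J.
  by move: cheb lw kJ kN' kl; move: (w.-1) => w'; clear; nia.
have main : size J * #|[set a in unitsmod m | k <= sh_maxload n a X]| * k * J0 <= 4 * n * m.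
  apply: card_rich_mul_le => //.
  by apply: leq_trans kn; apply: leq_trans kl.
have mt := leq_totient_log m0; rewrite -/w in mt.
move: #|_| main => c main.
(* The constant is 32 * 128, from [kJs] and [kJ']; times 4 from [main] it becomes [128 ^ 2]. *)
have kk : k ^ 2 <= 4096 * l ^ 2 * (size J * J0).
  by have := leq_mul kJs kJ'; rewrite -!mulnn; clear; lia.
have : c * k ^ 3 <= 4096 * l ^ 2 * (4 * n * m).
  apply: leq_trans (_ : c * k * (4096 * l ^ 2 * (size J * J0)) <= _).
    by rewrite expnS mulnA leq_mul2l kk orbT.
  rewrite mulnCA leq_mul2l; apply/orP; right.
  by move: main; clear; lia.
move/leq_trans; apply.
rewrite (_ : (128 * l) ^ 2 * w * n * totient m = 4096 * l ^ 2 * (4 * n * (w * totient m))).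
  by rewrite leq_mul2l leq_mul2l mt !orbT.
by rewrite -!mulnn; clear; lia.
Qed.

(** * From tail counts to the expected maxload *)

Lemma leq_sum_thresholds (L n k : nat) :
  L <= n -> L <= k + \sum_(k.+1 <= i < n.+1) (i <= L).
Proof.
move=> Ln; have [//|kL] := leqP L k; first by move=> Lk; apply: leq_trans Lk (leq_addr _ _).
rewrite (@big_cat_nat _ _ _ L.+1) //=; last by rewrite ltnW.
rewrite addnA; apply: leq_trans (leq_addr _ _).
rewrite (eq_big_nat _ _ (F2 := fun=> 1)) => [|i /andP[_ iL]]; last by rewrite -ltnS iL.
by rewrite sum_nat_const_nat; move: kL; clear; lia.
Qed.

Local Open Scope ring_scope.

Lemma sum_inv_cube_tail (R : realFieldType) (k n : nat) : (0 < k)%N ->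
  \sum_(k.+1 <= i < n.+1) (i%:R ^+ 3)^-1 <= (k%:R ^+ 2)^-1 :> R.
Proof.
move=> k0; rewrite big_add1 /=.
have [nk|kn] := leqP n k; first by rewrite big_geq // invr_ge0 exprn_ge0.
(* Since k <= i, the term 1 / (i + 1)^3 is at most 1 / k times 1 / (i (i + 1)), which telescopes. *)
apply: le_trans (_ : \sum_(k <= i < n) k%:R^-1 * (- i.+1%:R^-1 - - i%:R^-1) <= _).
  rewrite !big_nat; apply: ler_sum => i /andP[ki _].
  have kp : 0 < k%:R :> R by rewrite ltr0n.
  have ip : 0 < i%:R :> R by rewrite ltr0n (leq_trans k0).
  have ki' : k%:R <= i%:R :> R by rewrite ler_nat.
  have i1 : i.+1%:R = i%:R + 1 :> R by rewrite -addn1 natrD.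
  have i1p : 0 < i.+1%:R :> R by rewrite ltr0n.
  have -> : - i.+1%:R^-1 - - i%:R^-1 = (i.+1%:R * i%:R)^-1 :> R.
    by rewrite i1; field; rewrite -i1 !lt0r_neq0.
  rewrite -invfM lef_pV2 ?posrE ?mulr_gt0 ?exprn_gt0 //.
  rewrite !exprS expr0 mulr1 mulrC -mulrA ler_pM2l //.
  by apply: ler_pM; rewrite ?ler0n // ler_nat ?leqW.
rewrite -mulr_sumr telescope_sumr ?(ltnW kn) // expr2 invfM.
by rewrite ler_wpM2l ?invr_ge0 // opprK gerDr oppr_le0 invr_ge0.
Qed.

Lemma sh_maxload_le_card (m n : nat) (a : 'I_m) (X : {set 'I_m}) :
  (sh_maxload n a X <= #|X|)%N.
Proof.
apply/bigmax_leqP => b _; apply: subset_leq_card.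
by apply/subsetP => x; rewrite inE => /andP[].
Qed.

(** A layer-cake sum: thresholds up to [k] cost [k], and each [i > k] costs the proportion of
    multipliers rich at level [i], which decays like 1 / i^3. *)
Lemma expected_maxload_le (R : realFieldType) (m n k : nat) (X : {set 'I_m}) :
  let l := (trunc_log 2 n).+1 in let w := (trunc_log 2 m).+1 in
  (0 < m)%N -> #|X| = n -> (64 * l * w <= k)%N ->
  sh_expected_maxload R n X <= k%:R + ((128 * l) ^ 2 * w)%:R * n%:R / k%:R ^+ 2.
Proof.
move=> l w m0 Xn lwk; rewrite /sh_expected_maxload card_unitsmod.
have k0 : (0 < k)%N by apply: leq_trans lwk; rewrite !muln_gt0.
have t0 : 0 < (totient m)%:R :> R by rewrite ltr0n totient_gt0.
pose A i := #|[set a in unitsmod m | (i <= sh_maxload n a X)%N]|.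
have cnt : (\sum_(a in unitsmod m) sh_maxload n a X <=
    totient m * k + \sum_(k.+1 <= i < n.+1) A i)%N.
  apply: leq_trans (_ : \sum_(a in unitsmod m)
      (k + \sum_(k.+1 <= i < n.+1) (i <= sh_maxload n a X)%N) <= _)%N.
    apply: leq_sum => a _; apply: leq_sum_thresholds.
    by rewrite -Xn sh_maxload_le_card.
  rewrite big_split /= sum_nat_const card_unitsmod leq_add2l exchange_big /=.
  apply: leq_sum => i _; rewrite /A -sum1_card [leqRHS]big_mkcond [leqLHS]big_mkcond.
  by apply: leq_sum => a _; rewrite inE; case: (a \in _) => //=; case: leq.
rewrite -natr_sum ler_pdivrMr //.
apply: le_trans (_ : (totient m * k)%:R + \sum_(k.+1 <= i < n.+1) (A i)%:R <= _).
  by rewrite -natr_sum -natrD ler_nat.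
rewrite mulrDl natrM [_ * k%:R]mulrC lerD2l.
set Q := (_ ^ 2 * w)%N.
apply: le_trans (_ : \sum_(k.+1 <= i < n.+1) Q%:R * n%:R * (totient m)%:R * (i%:R ^+ 3)^-1 <= _).
  rewrite !big_nat; apply: ler_sum => i /andP[ki iN].
  have i0 : 0 < i%:R ^+ 3 :> R by rewrite exprn_gt0 // ltr0n (leq_trans _ ki).
  rewrite ler_pdivlMr // -natrX -!natrM ler_nat.
  by apply: card_rich_multipliers => //; apply: leq_trans lwk (ltnW ki).
rewrite -mulr_sumr [leRHS]mulrAC ler_wpM2l ?mulr_ge0 ?ler0n //.
exact: sum_inv_cube_tail.
Qed.

(** * The expected maxload *)

Lemma trunc_log2_le_ln (R : realType) (n : nat) : (0 < n)%N ->
  (trunc_log 2 n)%:R <= 2 * ln (n%:R : R).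
Proof.
move=> n0; have ln2 : 2^-1 <= ln 2 :> R.
  have : ln (1 + - 2^-1) <= - 2^-1 :> R by apply: le_ln1Dx; lra.
  have -> : 1 + - 2^-1 = 2^-1 :> R by lra.
  by rewrite lnV ?posrE ?ltr0n // lerN2.
have : ln ((2 : R) ^+ trunc_log 2 n) <= ln (n%:R : R).
  by rewrite ler_ln ?posrE ?exprn_gt0 ?ltr0n // -natrX ler_nat trunc_logP.
rewrite lnXn ?ltr0n // -[ln 2 *+ _]mulr_natl => h.
have : (trunc_log 2 n)%:R * 2^-1 <= (trunc_log 2 n)%:R * ln 2 :> R.
  by rewrite ler_wpM2l ?ler0n.
by move: h; lra.
Qed.

Lemma M_SH_le (R : realType) (m n : nat) (s : R) :
  let l := (trunc_log 2 n).+1 in let w := (trunc_log 2 m).+1 in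
  (0 < m)%N -> 1 <= s -> s ^+ 3 = n%:R -> M_SH R m n <= s * (16450 * l%:R ^+ 2 * w%:R).
Proof.
move=> l w m0 s1 s3; rewrite /M_SH.
have l1 : 1 <= l%:R :> R by rewrite ler1n.
have w1 : 1 <= w%:R :> R by rewrite ler1n.
have l2 : 1 <= l%:R ^+ 2 :> R by rewrite exprn_ege1.
apply: bigmax_le => [|X /eqP Xn]; first by rewrite !mulr_ge0 ?exprn_ge0 //; lra.
(* With [s] the cube root of [n], this choice balances [k] against [n / k ^ 2]; the second summand
   meets the lower bound required on [k]. The final 16450 is 16384 + 64 + 1 + 1. *)
pose k := ((Num.truncn s).+1 + 64 * l * w)%N.
apply: le_trans (expected_maxload_le R m0 Xn (leq_addl _ _ : (64 * l * w <= k)%N)) _.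
rewrite -/l -/w -s3.
have sk : s <= k%:R.
  by apply: le_trans (ltW (truncnS_gt s)) _; rewrite ler_nat leq_addr.
have ks : k%:R <= s + 1 + 64 * l%:R * w%:R.
  rewrite /k natrD !natrM lerD2r -addn1 natrD lerD2r truncn_le; lra.
have s0 : 0 < s by lra.
have k0 : 0 < k%:R :> R by lra.
have tail : ((128 * l) ^ 2 * w)%:R * s ^+ 3 / k%:R ^+ 2 <= ((128 * l) ^ 2 * w)%:R * s.
  rewrite -mulrA ler_wpM2l // ler_pdivrMr ?exprn_gt0 // exprS ler_pM2l //.
  by rewrite ler_pXn2r // nnegrE ltW.
apply: le_trans (lerD ks tail) _.
rewrite natrM natrX natrM exprMn.
have -> : 128%:R ^+ 2 = 16384 :> R by rewrite -natrX.
set a := l%:R ^+ 2 in l2 *.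
have lw : l%:R * w%:R <= a * w%:R by rewrite ler_wpM2r // /a expr2 ler_peMl // ; lra.
have aw : 1 <= a * w%:R by rewrite mulr_ege1.
have p1 : a * w%:R <= s * (a * w%:R) by rewrite ler_peMl //; lra.
have p2 : s <= s * (a * w%:R) by rewrite ler_peMr //; lra.
have -> : s * (16450 * a * w%:R) = 16450 * (s * (a * w%:R)) by ring.
have -> : 16384 * a * w%:R * s = 16384 * (s * (a * w%:R)) by ring.
have -> : 64 * l%:R * w%:R = 64 * (l%:R * w%:R) :> R by rewrite mulrA.
lra.
Qed.

Theorem mainTheorem2 (R : realType) (C : R) :
  exists (K n0 : nat), forall (n m : nat),
    (0 < n)%N -> (n0 <= n)%N ->
    n%:R `^ (5 / 2) < m%:R :> R ->
    m%:R <= n%:R `^ C ->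
    M_SH R m n <= n%:R `^ (1 / 3) * ln (n%:R : R) ^+ K.
Proof.
pose c := (Num.truncn `|C|).+1.
have Cc : C <= c%:R by apply: le_trans (ler_norm C) _; apply/ltW/truncnS_gt.
(* The factors come from [M_SH_le], from [l <= 3 * L] squared and from [w <= (2 * c + 1) * L]. *)
pose P := (16450 * 9 * (2 * c + 1))%N.
(* From 16 on, [L >= 2], so the constant [P < 2 ^ P] is absorbed by [P] extra powers of [L]. *)
exists (P + 3)%N, 16%N => n m n0 nN0 mlo mhi.
have m0 : (0 < m)%N by rewrite -(ltr0n R); apply: le_lt_trans (powR_ge0 _ _) mlo.
have nR : 0 < n%:R :> R by rewrite ltr0n.
have n1 : 1 <= n%:R :> R by rewrite ler1n.
set s := n%:R `^ (1 / 3); set L := ln n%:R.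
have L2 : 2 <= L.
  have : 4 <= (trunc_log 2 n)%:R :> R by rewrite ler_nat trunc_log_max.
  by have := trunc_log2_le_ln R n0; rewrite -/L; lra.
have s3 : s ^+ 3 = n%:R.
  rewrite -powR_mulrn ?powR_ge0 // -powRrM.
  by rewrite (_ : 1 / 3 * 3%:R = 1) ?powRr1 ?ler0n //; field.
have s1 : 1 <= s.
  by rewrite /s -[X in X <= _](powRr0 n%:R) ler_powR //; lra.
apply: le_trans (M_SH_le m0 s1 s3) _.
rewrite ler_wpM2l ?powR_ge0 //.
set l := (trunc_log 2 n).+1; set w := (trunc_log 2 m).+1.
have lL : l%:R <= 3 * L.
  rewrite /l -addn1 natrD; have := trunc_log2_le_ln R n0; rewrite -/L; lra.
have wL : w%:R <= (2 * c + 1)%:R * L.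
  have lnm : ln (m%:R : R) <= c%:R * L.
    apply: le_trans (_ : C * L <= _); last by rewrite ler_wpM2r //; lra.
    by rewrite /L -ln_powR ler_ln ?posrE ?powR_gt0 // ltr0n.
  rewrite /w -addn1 natrD natrD natrM.
  by have := trunc_log2_le_ln R m0; move: lnm L2; nra.
have L0 : 0 <= L by lra.
apply: le_trans (_ : P%:R * L ^+ 3 <= _).
  have l2 : l%:R ^+ 2 <= 9 * L ^+ 2.
    apply: le_trans (_ : (3 * L) ^+ 2 <= _); last by rewrite exprMn -natrX.
    by rewrite ler_pXn2r // nnegrE // mulr_ge0.
  have -> : P%:R * L ^+ 3 = 16450 * (9 * L ^+ 2 * ((2 * c + 1)%:R * L)).
    by rewrite /P !natrM; ring.
  by rewrite -mulrA ler_wpM2l // ler_pM // exprn_ge0.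
rewrite exprD ler_wpM2r ?exprn_ge0 //.
apply: le_trans (_ : (2 : R) ^+ P <= _); last by rewrite ler_pXn2r // nnegrE.
by rewrite -natrX ler_nat ltnW // ltn_expl.
Qed.
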